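(* Assume that $(K,v)$ is henselian and let $f\in K[X]\setminus K$. Then there exists $\nu_0<\lambda$ such that for all $\nu$ with $\nu_0<\nu<\lambda$, considering the Taylor expansion $$f(X)-f(z_\nu)=\sum_{i=1}^{n}c_i(X-z_\nu)^i,\qquad c_i\in K,$$ we have $$h_K(X:f)=j_{w_\nu}\bigl(f(X)-f(z_\nu)\bigr)=\max\bigl\{\,i \;\big|\; w_\nu\bigl(f(X)-f(z_\nu)\bigr)=w\bigl(c_i(X-z_\nu)^i\bigr)\bigr\}$$ and $$\beta_K(X:f)=v c_h,\quad\text{where } h=h_K(X:f).$$ In particular, the relative approximation degree $h_K(X:f)$ and the relative approximation constant $\beta_K(X:f)$ exist.
   Context: Setting: $(K,v)$ is a valued field with $\operatorname{char}K=p$ an odd prime, $X$ is transcendental over $K$, and $(K(X)|K,w)$ is an immediate extension of valued fields ($wK(X)=vK$ and $K(X)w=Kv$). Fix an extension of $w$ to the algebraic closure $\overline{K(X)}$, again denoted $w$; its restriction to $\overline K$ is denoted $v$. A sequence $\{z_\nu\}_{\nu<\lambda}\subset K$ ($\lambda$ a limit ordinal) is pseudo-convergent if $v(z_\nu-z_\mu)<v(z_\mu-z_\rho)$ for all $\nu<\mu<\rho<\lambda$. Put $\gamma_\nu:=v(z_\nu-z_{\nu+1})$; an element $Y\in\overline{K(X)}$ is a limit of the sequence if $w(Y-z_\nu)=\gamma_\nu$ for all $\nu<\lambda$. Fix a pseudo-convergent sequence $\mathcal C=\{z_\nu\}_{\nu<\lambda}\subset K$ without a limit in $K$ and with $X$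 as a limit (one exists since $(K(X)|K,w)$ is immediate). Relative approximation degree and constant: for $f\in K[X]$, if there exist $\nu_0<\lambda$, a positive integer $h$ and $\beta\in vK$ with $w(f(X)-f(z_\nu))=\beta+h\,w(X-z_\nu)$ for all $\nu_0<\nu<\lambda$, then $h_K(X:f):=h$ and $\beta_K(X:f):=\beta$. Monomial valuations: $w_\nu$ is the valuation on $\overline K(X)$ (and $K(X)$) given on polynomials by $w_\nu\bigl(\sum_i c_i(X-z_\nu)^i\bigr)=\min_i\{v c_i+i\gamma_\nu\}$. $j$-invariant: for nonzero $g\in K[X]$, $j_{w_\nu}(g)$ is the number of roots $z\in\overline K$ of $g$, counted with multiplicity, such that $v(z_\nu-z)\ge\gamma_\nu$. *)

(* Defs.v *)
Set Warnings "-notation-overridden,-ambiguous-paths,-redundant-canonical-projection".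
From HB Require Import structures.
From mathcomp Require Import all_boot all_order all_algebra all_field.

Set Implicit Arguments.
Unset Strict Implicit.
Unset Printing Implicit Defensive.

Import Order.TTheory GRing.Theory Num.Theory.

Local Open Scope ring_scope.

(** ** Ordered abelian groups and their extension by infinity *)

HB.mixin Record isOrderedGroup G
    of Num.POrderedZmodule G := {
  ogroup_total : total (<=%R : rel G);
  ogroup_leD2r : forall c a b : G, a <= b -> a + c <= b + c
}.

#[short(type="orderedGroupType")]
HB.structure Definition OrderedGroup :=
  { G of isOrderedGroup G & Num.POrderedZmodule G }.

(* [None] is the value infinity: it is absorbing for [+] and the top for [<=]. *)
Definition withtop (G : Type) : Type := option G.

HB.instance Definition _ (G : choiceType) := Choice.on (withtop G).

Section WithTop.
Variable G : orderedGroupType.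
Implicit Types a b c : withtop G.

Definition wt_add a b : withtop G :=
  if a is Some x then (if b is Some y then Some (x + y) else None) else None.

Definition wt_le a b : bool :=
  if b is Some y then (if a is Some x then x <= y else false) else true.

Definition wt_lt a b : bool := (b != a) && wt_le a b.
Definition wt_min a b : withtop G := if wt_lt a b then a else b.
Definition wt_max a b : withtop G := if wt_lt a b then b else a.

Fact wt_addA : associative wt_add.
Proof. by move=> [a|] [b|] [c|] //=; rewrite addrA. Qed.

Fact wt_addC : commutative wt_add.
Proof. by move=> [a|] [b|] //=; rewrite addrC. Qed.

Fact wt_add0 : left_id (Some 0 : withtop G) wt_add.
Proof. by move=> [a|] //=; rewrite add0r. Qed.

HB.instance Definition _ :=
  GRing.isNmodule.Build (withtop G) wt_addA wt_addC wt_add0.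

Fact wt_le_anti : antisymmetric wt_le.
Proof. by move=> [a|] [b|] //= /le_anti ->. Qed.

Fact wt_le_trans : transitive wt_le.
Proof. by move=> [a|] [b|] [c|] //=; apply: le_trans. Qed.

Fact wt_le_total : total wt_le.
Proof. by move=> [a|] [b|] //=; apply: ogroup_total. Qed.

HB.instance Definition _ :=
  Order.isOrder.Build ring_display (withtop G)
    (fun _ _ => erefl) (fun _ _ => erefl) (fun _ _ => erefl)
    wt_le_anti wt_le_trans wt_le_total.

Fact wt_le_top a : a <= None :> withtop G.
Proof. by []. Qed.

HB.instance Definition _ := Order.hasTop.Build ring_display (withtop G) wt_le_top.

End WithTop.

(** ** Valuations *)

Record is_valuation (F : fieldType) (G : orderedGroupType)
    (v : F -> withtop G) : Prop := IsValuation {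
  valuation_top : forall x, v x = None <-> x = 0;
  valuationM : forall x y, v (x * y) = v x + v y;
  valuationD : forall x y, Order.min (v x) (v y) <= v (x + y)
}.

(* [v] has a unique extension to the algebraic closure of [K].  Extensions may
   take their values in any ordered group containing that of [v]; two of them
   always have a common such group, as the value group of the algebraic closure
   embeds into the divisible hull of the one of [K]. *)
Definition henselian (K : fieldType) (G : orderedGroupType)
    (v : K -> withtop G) : Prop :=
  forall (E : closedFieldType) (emb : {rmorphism K -> E}),
    (forall y : E, algebraicOver emb y) ->
  forall (H : orderedGroupType) (e : {additive G -> H}),
    {mono e : a b / a <= b} ->
  forall u1 u2 : E -> withtop H,
    is_valuation u1 -> is_valuation u2 ->
    (forall c : K, u1 (emb c) = omap e (v c)) ->
    (forall c : K, u2 (emb c) = omap e (v c)) ->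
    u1 =1 u2.

Definition in_value_group (K : fieldType) (G : orderedGroupType)
    (v : K -> withtop G) (g : G) : Prop :=
  exists2 b : K, b != 0 & v b = Some g.

(* The extension of valued fields [emb : K -> E], [E] being equipped with [u] and
   [K] with the restriction of [u], has the same value group and the same
   residue field: the second condition says that the residue of every [x] in the
   valuation ring of [u] is the residue of an element of the valuation ring of
   [K]. *)
Definition immediate (K E : fieldType) (G : orderedGroupType)
    (emb : K -> E) (u : E -> withtop G) : Prop :=
  (forall g : G, in_value_group u g <-> in_value_group (u \o emb) g) /\
  (forall x : E, (0 : withtop G) <= u x ->
     exists2 c : K, (0 : withtop G) <= u (emb c)
                  & (0 : withtop G) < u (x - emb c)).

(** ** Pseudo-convergent sequences *)

(* [I] is a limit ordinal, up to isomorphism: a nonempty well-order together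
   with its (everywhere defined) successor map. *)
Definition limit_ordinal d (I : orderType d) (succ : I -> I) : Prop :=
  [/\ inhabited I,
      well_founded (fun i j : I => (i < j)%O)
    & forall i j : I, (i < j)%O = (succ i <= j)%O].

Section PseudoConvergent.
Variables (K L : fieldType) (G : orderedGroupType) (emb : K -> L).
Variables (w : L -> withtop G) (d : Order.disp_t) (I : orderType d).
Variables (succ : I -> I) (z : I -> K).

Definition pseudo_convergent : Prop :=
  forall nu mu rho : I, (nu < mu)%O -> (mu < rho)%O ->
    w (emb (z nu - z mu)) < w (emb (z mu - z rho)).

Definition pc_gamma (nu : I) : withtop G := w (emb (z nu - z (succ nu))).

Definition pc_limit (Y : L) : Prop :=
  forall nu : I, w (Y - emb (z nu)) = pc_gamma nu.

(* [h] and [beta] satisfy the property defining the relative approximation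
   degree and the relative approximation constant of [f] at [X]. *)
Definition relative_approximation (X : L) (f : {poly K})
    (h : nat) (beta : G) : Prop :=
  [/\ (0 < h)%N, in_value_group (w \o emb) beta
    & exists nu0 : I, forall nu : I, (nu0 < nu)%O ->
        w ((map_poly emb f).[X] - emb f.[z nu]) =
        (Some beta : withtop G) + w (X - emb (z nu)) *+ h].

End PseudoConvergent.

(** ** Monomial valuations *)

(* The coefficient [c_i] in the expansion [g = \sum_i c_i *: ('X - a%:P) ^+ i]. *)
Definition taylor_coef (K : fieldType) (g : {poly K}) (a : K) (i : nat) : K :=
  (g \Po ('X + a%:P))`_i.

Definition monomial_val (K : fieldType) (G : orderedGroupType)
    (v : K -> withtop G) (a : K) (gamma : withtop G) (g : {poly K}) :
    withtop G :=
  \big[Order.min / \top%O]_(i < size g) (v (taylor_coef g a i) + gamma *+ i).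

(* [L] is an algebraically closed extension of [K]; a nonzero [g] over [K]
   splits in [L] and its roots there are exactly its roots in the algebraic
   closure of [K] inside [L]. *)
Definition j_invariant (K : fieldType) (L : closedFieldType)
    (G : orderedGroupType) (emb : K -> L) (w : L -> withtop G)
    (a : K) (gamma : withtop G) (g : {poly K}) : nat :=
  count (fun r : L => gamma <= w (emb a - r))
        (sval (closed_field_poly_normal (map_poly emb g))).

(* Main.v *)
(** Let [h_nu] be the number of roots of [f - f(z_nu)] in the closed ball of radius
   [gamma_nu] around [z_nu]; read off the Newton polygon, it is the last index at
   which the minimum of [v c_i + i gamma_nu] is attained.  Recentring at a [z_mu]
   closer to [X] preserves the value of the coefficient of index [h_nu] and keeps
   the higher terms strictly bigger, so [h_nu] is nonincreasing in [nu], hence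
   eventually a constant [h], and [v c_h] is then constant too.  Once [h] is stable,
   the expansion at [z_mu] with [mu > nu] gives
   [v (f(z_nu) - f(z_mu)) = v c_h + h gamma_nu], whereas [f(X) - f(z_mu)] has
   strictly bigger value.  This computes [w (f(X) - f(z_nu))]. *)

Require Import Defs.
Set Warnings "-notation-overridden,-ambiguous-paths".
From HB Require Import structures.
From mathcomp Require Import all_boot all_order all_algebra all_field.
From Stdlib Require Import Classical.

Set Implicit Arguments.
Unset Strict Implicit.
Unset Printing Implicit Defensive.

Import Order.TTheory GRing.Theory Num.Theory.

Local Open Scope ring_scope.

(** * Order and cancellation in an ordered group with infinity adjoined *)

Section WithTopTheory.
Variable G : orderedGroupType.
Implicit Types (a b c d : withtop G).

Lemma wt_leD2r c a b : a <= b -> a + c <= b + c.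
Proof. by case: a b c => [a|] [b|] [c|] //; apply: ogroup_leD2r. Qed.

Lemma wt_ltD2r c a b : c < None -> a < b -> a + c < b + c.
Proof.
case: c => [c|] // _; rewrite lt_neqAle => /andP[nab leab].
rewrite lt_neqAle wt_leD2r // andbT.
apply: contra nab; case: a b {leab} => [a|] [b|] // /eqP [] /addIr -> //.
Qed.

Lemma wt_leD a b c d : a <= b -> c <= d -> a + c <= b + d.
Proof.
move=> leab lecd; apply: le_trans (wt_leD2r c leab) _.
by rewrite ![b + _]addrC wt_leD2r.
Qed.

Lemma wt_lt_leD a b c d : c < None -> a < b -> c <= d -> a + c < b + d.
Proof.
move=> cfin ltab lecd; apply: lt_le_trans (wt_ltD2r cfin ltab) _.
exact: wt_leD.
Qed.

Lemma wt_le_ltD a b c d : a < None -> a <= b -> c < d -> a + c < b + d.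
Proof. by move=> *; rewrite ![_ + c]addrC ![_ + d]addrC; apply: wt_lt_leD. Qed.

Lemma wt_leD2rE c a b : c < None -> (a + c <= b + c) = (a <= b).
Proof.
move=> cfin; apply/idP/idP; last exact: wt_leD2r.
by apply: contraTT; rewrite -!ltNge; apply: wt_ltD2r.
Qed.

Lemma wt_ltD2rE c a b : c < None -> (a + c < b + c) = (a < b).
Proof. by move=> cfin; rewrite !ltNge wt_leD2rE. Qed.

Lemma wt_addI c a b : c < None -> c + a = c + b -> a = b.
Proof.
by case: c a b => [c|] [a|] [b|] // _ [] /addrI ->.
Qed.

Lemma wt_finD a b : (a + b < None) = (a < None) && (b < None).
Proof. by case: a b => [a|] [b|]. Qed.

Lemma wt_finMn a n : a < None -> a *+ n < None.
Proof. by move=> afin; elim: n => [|n IHn] //; rewrite mulrS wt_finD afin. Qed.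

Lemma wt_leMn a b n : a <= b -> a *+ n <= b *+ n.
Proof.
by move=> leab; elim: n => [|n IHn]; rewrite ?mulr0n // !mulrS wt_leD.
Qed.

Lemma wt_ltMn a b n : (0 < n)%N -> a < b -> a *+ n < b *+ n.
Proof.
case: n => // n _ ltab; rewrite !mulrS.
have afin : a < None by apply: lt_le_trans ltab _; apply: lex1.
by apply: wt_lt_leD; rewrite ?wt_finMn // wt_leMn ?ltW.
Qed.

Lemma wt_finP a : reflect (exists x : G, a = Some x) (a < None).
Proof. by case: a => [a|]; constructor; [exists a | case]. Qed.

(** Regard both sides as affine functions of the radius: the one of larger slope [j] drops strictly
    more when the radius decreases from [b] to [a]. *)
Lemma wt_slope_lt a b c d i j : a < b -> b < None -> d < None -> (i < j)%N ->
  d + b *+ j <= c + b *+ i -> d + a *+ j < c + a *+ i.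
Proof.
move=> ltab bfin dfin ltij; have afin := lt_trans ltab bfin.
rewrite -(subnK (ltnW ltij)) !mulrnDr !addrA wt_leD2rE ?wt_finMn // => ledc.
rewrite wt_ltD2rE ?wt_finMn //; apply: lt_le_trans ledc.
by rewrite wt_le_ltD // wt_ltMn // subn_gt0.
Qed.

Lemma wt_slope_le a b c d i j : a <= b -> b < None -> (i <= j)%N ->
  d + a *+ i < c + a *+ j -> d + b *+ i < c + b *+ j.
Proof.
move=> leab bfin leij; have afin := le_lt_trans leab bfin.
rewrite -(subnK leij) !mulrnDr !addrA !wt_ltD2rE ?wt_finMn // => ltdc.
by apply: lt_le_trans ltdc _; rewrite wt_leD // wt_leMn.
Qed.

(** Unequal slopes would turn the equality at [b] into a strict inequality at [a]. This gives the
    uniqueness of the relative approximation degree and constant. *)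
Lemma wt_affine_inj a b c d i j : a < b -> b < None ->
    c < None -> d < None ->
    c + a *+ i = d + a *+ j -> c + b *+ i = d + b *+ j ->
  j = i /\ d = c.
Proof.
move=> ltab bfin cfin dfin ea eb; have afin := lt_trans ltab bfin.
have eij : j = i.
  have [ltji|ltij|//] := ltngtP j i.
    have leb : c + b *+ i <= d + b *+ j by rewrite eb.
    by have := wt_slope_lt ltab bfin cfin ltji leb; rewrite ea ltxx.
  have leb : d + b *+ j <= c + b *+ i by rewrite eb.
  by have := wt_slope_lt ltab bfin dfin ltij leb; rewrite ea ltxx.
split=> //; move: ea; rewrite eij ![_ + a *+ i]addrC => /esym.
exact/wt_addI/wt_finMn.
Qed.

End WithTopTheory.

(** * Valuations, Gauss norms and the Newton polygon *)

Section ValuationTheory.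
Variables (F : fieldType) (G : orderedGroupType) (w : F -> withtop G).
Hypothesis vw : is_valuation w.
Implicit Types (x y r s : F) (t g : withtop G) (q : {poly F}).

Lemma val0 : w 0 = None.
Proof. exact/(valuation_top vw). Qed.

Lemma val_fin x : (w x < None) = (x != 0).
Proof.
have [topx zx] := valuation_top vw x; apply/idP/idP => [fin|].
  by apply/eqP => /zx wx; rewrite wx in fin.
by apply: contraR; case: (w x) topx => // topx _; apply/eqP/topx.
Qed.

Lemma val1 : w 1 = 0.
Proof.
have fin1 : w 1 < None by rewrite val_fin oner_eq0.
by apply: (wt_addI fin1); rewrite -(valuationM vw) mulr1 addr0.
Qed.

Lemma valX x n : w (x ^+ n) = w x *+ n.
Proof.
by elim: n => [|n IHn]; rewrite ?val1 // exprS mulrS (valuationM vw) IHn.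
Qed.

Lemma valN x : w (- x) = w x.
Proof.
suff w1 : w (-1) = 0 by rewrite -mulN1r (valuationM vw) w1 add0r.
have w2 : w (-1) *+ 2 = 0 by rewrite -valX sqrrN expr1n val1.
have [lt1|gt1|//] := ltgtP (w (-1)) 0.
  by have := wt_ltMn (isT : (0 < 2)%N) lt1; rewrite w2 mul0rn ltxx.
by have := wt_ltMn (isT : (0 < 2)%N) gt1; rewrite w2 mul0rn ltxx.
Qed.

Lemma val_distC x y : w (x - y) = w (y - x).
Proof. by rewrite -valN opprB. Qed.

(** The shift [g] stands for the weight [i * gamma] that a coefficient of index [i] carries in a
    Gauss norm. *)
Lemma val_geD t g x y : t <= w x + g -> t <= w y + g -> t <= w (x + y) + g.
Proof.
move=> tx ty; apply: le_trans (wt_leD2r g (valuationD vw x y)).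
by case: (leP (w x) (w y)).
Qed.

Lemma val_gtD t g x y : t < w x + g -> t < w y + g -> t < w (x + y) + g.
Proof.
move=> tx ty; apply: lt_le_trans (wt_leD2r g (valuationD vw x y)).
by case: (leP (w x) (w y)).
Qed.

Lemma val_ge_sum (J : Type) (r : seq J) (P : pred J) (E : J -> F) t g :
  (forall i, P i -> t <= w (E i) + g) -> t <= w (\sum_(i <- r | P i) E i) + g.
Proof.
move=> tE; elim/big_ind: _ => [|x y|i]; last exact: tE.
  by rewrite val0 lex1.
exact: val_geD.
Qed.

Lemma val_gt_sum (J : Type) (r : seq J) (P : pred J) (E : J -> F) t g :
    t < None -> (forall i, P i -> t < w (E i) + g) ->
  t < w (\sum_(i <- r | P i) E i) + g.
Proof.
move=> tfin tE; elim/big_ind: _ => [|x y|i]; last exact: tE.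
  by rewrite val0.
exact: val_gtD.
Qed.

Lemma val_addl x y : w x < w y -> w (x + y) = w x.
Proof.
move=> ltxy; apply/le_anti/andP; split; last first.
  by apply: le_trans (valuationD vw x y); rewrite le_min lexx ltW.
have := valuationD vw (x + y) (- y); rewrite addrK valN ge_min.
by case/orP => // leyx; rewrite ltNge leyx in ltxy.
Qed.

Lemma val_addl_shift g x y : w x + g < w y + g -> w (x + y) = w x.
Proof.
move=> ltxy; apply: val_addl; rewrite ltNge; apply: contraTN ltxy => leyx.
by rewrite -leNgt wt_leD2r.
Qed.

(** Integer multiples never lower a value; this absorbs the binomial coefficients of a Taylor shift,
    even those that vanish in [F]. *)
Lemma val_gtMn t g x n : t < w x + g -> t < w (x *+ n) + g.
Proof.
move=> tx; elim: n => [|n IHn]; last by rewrite mulrS val_gtD.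
by rewrite val0; apply: lt_le_trans tx _; apply: lex1.
Qed.

(* [h] is the last index at which the Gauss norm of radius [g] is attained. *)
Definition newton_vertex q g (h : nat) : Prop :=
  (forall i, w q`_h + g *+ h <= w q`_i + g *+ i) /\
  (forall i, (h < i)%N -> w q`_h + g *+ h < w q`_i + g *+ i).

Lemma newton_vertex_fin q g h :
  newton_vertex q g h -> w q`_h + g *+ h < None.
Proof.
case=> _ /(_ _ (leq_addl (size q) h.+1))/lt_le_trans; apply; exact: lex1.
Qed.

(** Induction on the roots: in [('X - r) * q] the part ['X * q] decides if [g <= w r], and the
    vertex moves up by one; otherwise [r * q] decides, and the vertex stays. *)
Lemma newton_vertex_roots c (rs : seq F) g : c != 0 -> g < None ->
  newton_vertex (c *: \prod_(r <- rs) ('X - r%:P)) g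
                (count (fun r => g <= w r) rs).
Proof.
move=> c0 gfin; elim: rs => [|r rs].
  rewrite big_nil alg_polyC /=; split=> i; rewrite !coefC.
    by case: i => [|i]; rewrite ?lexx // val0 lex1.
  by case: i => // i _; rewrite val0 addr0 val_fin.
rewrite big_cons scalerAr; set q := c *: _ => vq.
have mfin := newton_vertex_fin vq; case: vq => qge qgt.
have coefq i : ((('X - r%:P) : {poly F}) * q)`_i
    = (if i == 0%N then 0 else q`_i.-1) - r * q`_i.
  by rewrite mulrBl coefB coefXM coefCM.
rewrite /=; set h := count _ _ in qge qgt mfin *.
have [rge|rlt] := leP g (w r); rewrite ?add1n ?add0n.
  have xge i : w q`_h + g *+ h + g
      <= w (if i == 0%N then 0 else q`_i.-1) + g *+ i.
    case: i => [|i] /=; first by rewrite val0 lex1.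
    by rewrite mulrSr addrA wt_leD2r.
  have yge i : w q`_h + g *+ h + g <= w (- (r * q`_i)) + g *+ i.
    by rewrite valN (valuationM vw) -(addrA (w r)) [X in _ <= X]addrC wt_leD.
  have ygt i : (h < i)%N ->
      w q`_h + g *+ h + g < w (- (r * q`_i)) + g *+ i.
    move=> hi; rewrite valN (valuationM vw) -(addrA (w r)) [X in _ < X]addrC.
    by rewrite wt_lt_leD // qgt.
  (* No cancellation with [r * q_(h+1)] is possible, because [h] is the last index attaining the
     norm of [q]. *)
  have top : w (('X - r%:P) * q)`_h.+1 = w q`_h.
    rewrite coefq /=; apply: (val_addl_shift (g := g *+ h.+1)).
    by rewrite {1}mulrSr addrA ygt.
  split=> i; rewrite top mulrSr addrA coefq; first exact: val_geD.
  case: i => // i hi; apply: val_gtD; last exact/ygt/ltnW.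
  by rewrite /= mulrSr addrA wt_ltD2rE // qgt.
have rfin : w r < None by apply: lt_trans rlt gfin.
have xgt i : w r + (w q`_h + g *+ h)
    < w (if i == 0%N then 0 else q`_i.-1) + g *+ i.
  case: i => [|i] /=; first by rewrite val0 wt_finD rfin.
  by rewrite mulrSr (addrA (w q`_i)) [X in _ < X]addrC wt_lt_leD.
have yE i : w (- (r * q`_i)) + g *+ i = w r + (w q`_i + g *+ i).
  by rewrite valN (valuationM vw) addrA.
(* Here [w r < g] makes every term coming from ['X * q] strictly bigger. *)
have top : w (('X - r%:P) * q)`_h = w (- (r * q`_h)).
  rewrite coefq addrC; apply: (val_addl_shift (g := g *+ h)).
  by rewrite yE xgt.
split=> i; rewrite top yE coefq.
  by apply: val_geD; [apply/ltW/xgt | rewrite yE wt_leD].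
by move=> hi; apply: val_gtD => //; rewrite yE wt_le_ltD // qgt.
Qed.

(** The coefficient is the [j]-th Hasse derivative of [q] at [s]; divided derivatives avoid
    factorials, which may vanish in [F]. *)
Lemma coef_comp_XaddC q s j :
  (q \Po ('X + s%:P))`_j =
    \sum_(i < size q) q`_(j + i) *+ 'C(j + i, j) * s ^+ i.
Proof.
rewrite /comp_poly addrC nderiv_taylor; last exact: commr_polyX.
rewrite size_map_polyC.
transitivity (q^`N(j).[s]).
  have -> : \sum_(i < size q) (q^:P^`N(i)).[s%:P] * 'X^i
      = \poly_(i < size q) (q^`N(i)).[s].
    rewrite poly_def; apply: eq_bigr => i _.
    by rewrite nderivn_map horner_map mul_polyC.
  rewrite coef_poly; case: ltnP => // szq.
  by rewrite nderivn_poly0 ?horner0.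
have szd : (size q^`N(j) <= size q)%N.
  apply/leq_sizeP => i szi; rewrite coef_nderivn nth_default ?mul0rn //.
  by rewrite (leq_trans szi) ?leq_addl.
rewrite (horner_coef_wide _ szd).
by apply: eq_bigr => i _; rewrite coef_nderivn.
Qed.

(** As [g <= w s], the term in [q_(j+i) * s ^ i] has weight at least that of index [j + i] in [q],
    hence strictly above the minimum once [j + i > h]. In the coefficient of index [h] only the term
    [i = 0] escapes this bound. *)
Lemma newton_vertex_shift q g h s : newton_vertex q g h -> g <= w s ->
  w (q \Po ('X + s%:P))`_h = w q`_h /\
  (forall j, (h < j)%N ->
     w q`_h + g *+ h < w (q \Po ('X + s%:P))`_j + g *+ j).
Proof.
move=> vq gs; have mfin := newton_vertex_fin vq; case: vq => qge qgt.
have term_gt i j : (h < j + i)%N ->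
    w q`_h + g *+ h < w (q`_(j + i) *+ 'C(j + i, j) * s ^+ i) + g *+ j.
  move=> hij; rewrite mulrnAl; apply: val_gtMn.
  rewrite (valuationM vw) valX; apply: lt_le_trans (qgt _ hij) _.
  by rewrite -addrA wt_leD // mulrnDr addrC wt_leD // wt_leMn.
split=> [|j hj]; last first.
  rewrite coef_comp_XaddC; apply: val_gt_sum => // i _.
  by rewrite term_gt ?ltn_addr.
have qh0 : q`_h != 0 by move: mfin; rewrite wt_finD val_fin => /andP[].
have: (h < size q)%N.
  by rewrite ltnNge; apply: contra qh0 => /(nth_default 0) ->.
rewrite coef_comp_XaddC; case: (size q) => // n _.
rewrite big_ord_recl /= addn0 binn mulr1 mulr1n.
apply: (val_addl_shift (g := g *+ h)).
by apply: val_gt_sum => // i _; rewrite term_gt // addnS ltnS leq_addr.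
Qed.

End ValuationTheory.

(** Descent on a bound for [h i]: either some later index lowers it, or it is constant from [i]
    on. *)
Lemma eventually_constant d (I : orderType d) (i0 : I) (h : I -> nat) :
    (forall i j, (i < j)%O -> (h j <= h i)%N) ->
  exists i, forall j, (i < j)%O -> h j = h i.
Proof.
move=> hdec; move: {2}(h i0).+1 (ltnSn (h i0)) => n.
elim: n i0 => // n IHn i hi.
have [[j ij hj]|noj] := classic (exists2 j, (i < j)%O & (h j < h i)%N).
  by apply: (IHn j); apply: leq_trans hj _; rewrite -ltnS.
exists i => j ij; apply/eqP; rewrite eqn_leq hdec // leqNgt.
by apply/negP => hj; apply: noj; exists j.
Qed.

(** * Newton polygons recentred along a sequence approaching [X] *)

Section PseudoConvergence.
Variables (F : fieldType) (G : orderedGroupType) (w : F -> withtop G).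
Hypothesis vw : is_valuation w.
Variables (d : Order.disp_t) (I : orderType d) (a : I -> F) (X : F).
Hypothesis no_last : forall nu : I, exists mu : I, (nu < mu)%O.
Hypothesis dist_incr : forall nu mu : I, (nu < mu)%O ->
  w (X - a nu) < w (X - a mu).
Variable P : {poly F}.

Let gam nu := w (X - a nu).
Let q nu := (P - (P.[a nu])%:P) \Po ('X + (a nu)%:P).

Let gam_fin nu : gam nu < None.
Proof.
have [mu /dist_incr/lt_le_trans] := no_last nu.
by apply; exact: lex1.
Qed.

Let horner_q nu x : (q nu).[x - a nu] = P.[x] - P.[a nu].
Proof. by rewrite horner_comp !hornerE subrK. Qed.

Let coef0_q nu : (q nu)`_0 = 0.
Proof.
by rewrite -horner_coef0; have := horner_q nu (a nu); rewrite !subrr.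
Qed.

(** The subtracted constants [P.[a nu]] and [P.[a mu]] differ, so recentring is compatible only in
    positive degree. *)
Let coef_q nu mu j : (0 < j)%N ->
  (q mu)`_j = (q nu \Po ('X + (a mu - a nu)%:P))`_j.
Proof.
move=> j_gt0; rewrite /q -comp_polyA !comp_polyB comp_polyD !comp_polyC comp_polyX.
by rewrite polyCB -addrA subrK !coefB !coefC !gtn_eqF.
Qed.

Let dist_a nu mu : (nu < mu)%O -> w (a nu - a mu) = gam nu.
Proof.
move=> lt; have -> : a nu - a mu = - (X - a nu) + (X - a mu).
  by rewrite opprB addrA subrK.
by rewrite val_addl ?valN // dist_incr.
Qed.

(** The constant coefficient is zero, of infinite value, whereas the minimum is finite. *)
Lemma vertex_gt0 nu g h : newton_vertex w (q nu) g h -> (0 < h)%N.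
Proof.
move=> /newton_vertex_fin; case: h => //.
by rewrite coef0_q val0.
Qed.

(** The centres lie at distance exactly [gam nu], so the shift lemma applies at that radius. *)
Lemma vertex_coef_stable nu mu h h' : (nu < mu)%O ->
    newton_vertex w (q nu) (gam nu) h -> newton_vertex w (q mu) (gam mu) h' ->
  [/\ (h' <= h)%N, w (q mu)`_h = w (q nu)`_h
    & forall j, (h < j)%N ->
        w (q nu)`_h + gam nu *+ h < w (q mu)`_j + gam nu *+ j].
Proof.
move=> lt vnu [qge qgt]; have h_gt0 := vertex_gt0 vnu.
have [|topE gtE] := newton_vertex_shift (s := a mu - a nu) vw vnu.
  by rewrite val_distC ?dist_a.
rewrite -coef_q // in topE.
have gtE' j : (h < j)%N ->
    w (q nu)`_h + gam nu *+ h < w (q mu)`_j + gam nu *+ j.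
  by move=> hj; rewrite (coef_q nu mu (ltn_trans h_gt0 hj)) gtE.
(* If [h < h'], the strict inequality at [gam nu] persists at the larger [gam mu], the slope [h']
   being steeper, against the minimality of [h'] there. *)
split=> //; rewrite leqNgt; apply/negP => hh'.
have := wt_slope_le (ltW (dist_incr lt)) (gam_fin mu) (ltnW hh') (gtE' _ hh').
by rewrite -topE ltNge qge.
Qed.

(* Expand at [a mu], which is closer to [X] than [a nu]: at distance
   [gam nu] the term of index [h] strictly dominates all others, whereas all
   terms are bigger at [X]. *)
Lemma vertex_value nu mu h : (nu < mu)%O ->
    newton_vertex w (q nu) (gam nu) h -> newton_vertex w (q mu) (gam mu) h ->
  w (P.[X] - P.[a nu]) = w (q nu)`_h + gam nu *+ h.
Proof.
move=> lt vnu vmu; have [_ topE gtE] := vertex_coef_stable lt vnu vmu.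
have h_gt0 := vertex_gt0 vnu.
have := newton_vertex_fin vmu; rewrite topE wt_finD => /andP[bfin _].
have mfin := newton_vertex_fin vnu.
case: vmu; rewrite topE => qge _.
(* Indices below [h] are not smaller at [gam mu], so they become strictly bigger at [gam nu]; those
   above [h] are covered by [gtE]. *)
have others i : i != h ->
    w (q nu)`_h + gam nu *+ h < w ((q mu)`_i * (a nu - a mu) ^+ i).
  rewrite (valuationM vw) valX // dist_a // neq_ltn => /orP[ih|]; last exact: gtE.
  exact: (wt_slope_lt (dist_incr lt) (gam_fin mu) bfin ih).
have anu : w (P.[a nu] - P.[a mu]) = w (q nu)`_h + gam nu *+ h.
  rewrite -horner_q horner_coef.
  have h_lt : (h < size (q mu))%N.
    rewrite ltnNge; apply: contraL bfin => /(nth_default 0) qh.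
    by rewrite -topE qh val0.
  have hE : w ((q mu)`_h * (a nu - a mu) ^+ h) = w (q nu)`_h + gam nu *+ h.
    by rewrite (valuationM vw) valX // dist_a // topE.
  rewrite (bigD1 (Ordinal h_lt)) //= (val_addl_shift vw (g := 0)) // !addr0 hE.
  rewrite -[X in _ < X]addr0; apply: val_gt_sum => // i ih.
  by rewrite addr0 others.
have atX : w (q nu)`_h + gam nu *+ h < w (P.[X] - P.[a mu]).
  (* The intermediate value is the Gauss norm at radius [gam mu]; it exceeds the one at [gam nu]
     because [h > 0]. *)
  apply: (@lt_le_trans _ _ (w (q nu)`_h + gam mu *+ h)).
    by rewrite wt_le_ltD // wt_ltMn // dist_incr.
  rewrite -horner_q horner_coef -[X in _ <= X]addr0; apply: val_ge_sum => // i _.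
  by rewrite addr0 (valuationM vw) valX.
rewrite -anu in atX *.
have -> : P.[X] - P.[a nu] = - (P.[a nu] - P.[a mu]) + (P.[X] - P.[a mu]).
  by rewrite [RHS]addrC opprB addrA subrK.
by rewrite val_addl ?valN.
Qed.

Lemma eventual_vertex (h : I -> nat) (i0 : I) :
    (forall nu, newton_vertex w (q nu) (gam nu) (h nu)) ->
  exists (n : nat) (b : G) (nu0 : I), (0 < n)%N /\
    forall nu, (nu0 < nu)%O ->
      [/\ h nu = n, w (q nu)`_n = Some b
        & w (P.[X] - P.[a nu]) = (Some b : withtop G) + gam nu *+ n].
Proof.
move=> vh; have hdec i j : (i < j)%O -> (h j <= h i)%N.
  by move=> ij; have [] := vertex_coef_stable ij (vh i) (vh j).
have [nu0 hE] := eventually_constant i0 hdec.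
have := newton_vertex_fin (vh nu0); rewrite wt_finD => /andP[/wt_finP[b bE] _].
exists (h nu0), b, nu0; split=> [|nu lt]; first exact: vertex_gt0 (vh nu0).
have := vh nu; rewrite hE // => vnu.
have [_ topE _] := vertex_coef_stable lt (vh nu0) vnu.
(* The value at [nu] is computed from a later centre with the same vertex. *)
have [mu ltmu] := no_last nu.
have := vh mu; rewrite (hE mu (lt_trans lt ltmu)) => vmu.
by split; rewrite ?(vertex_value ltmu vnu vmu) ?topE ?bE.
Qed.

End PseudoConvergence.

(** * Relative approximation degree and constant of [f] at [X] *)

Theorem theorem1p3 (p : nat) (K : fieldType) (L : closedFieldType)
    (G : orderedGroupType)
    (iota : {rmorphism {fraction {poly K}} -> L}) (w : L -> withtop G)
    (d : Order.disp_t) (I : orderType d) (succ : I -> I) (z : I -> K)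
    (f : {poly K}) :
  (* L is an algebraic closure of K(X), and K is a subfield of L *)
  let KtoKX : K -> {fraction {poly K}} := fun c => FracField.tofrac c%:P in
  let emb : K -> L := fun c => iota (KtoKX c) in
  let X : L := iota (FracField.tofrac 'X) in
  let v : K -> withtop G := fun c => w (emb c) in
  let gamma : I -> withtop G := pc_gamma emb w succ z in
  odd p -> p \in [pchar K] ->
  (forall y : L, algebraicOver iota y) ->
  is_valuation w ->
  immediate KtoKX (fun x => w (iota x)) ->
  limit_ordinal succ ->
  pseudo_convergent emb w z ->
  (~ exists a : K, pc_limit emb w succ z (emb a)) ->
  pc_limit emb w succ z X ->
  henselian v ->
  (1 < size f)%N ->
  (exists (h : nat) (beta : G), relative_approximation emb w z X f h beta) /\
  (exists nu0 : I, forall nu : I, (nu0 < nu)%O ->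
     forall (h : nat) (beta : G),
       relative_approximation emb w z X f h beta ->
       let g : {poly K} := f - (f.[z nu])%:P in
       let c : nat -> K := taylor_coef g (z nu) in
       let w_nu : {poly K} -> withtop G := monomial_val v (z nu) (gamma nu) in
       [/\ h = j_invariant emb w (z nu) (gamma nu) g,
           h = \max_(1 <= i < size f
                     | w_nu g == w (emb (c i) * (X - emb (z nu)) ^+ i)) i
         & Some beta = v (c h)]).
Proof.
move=> KtoKX emb X v gamma _ _ _ vw _ [[i0] _ ltS] pc _ limX _ szf.
pose em : {rmorphism K -> L} := iota \o (@FracField.tofrac {poly K} \o polyC).
have emE c : emb c = em c by [].
have no_last nu : exists mu : I, (nu < mu)%O by exists (succ nu); rewrite ltS.
(* Pseudo-convergence is applied along [nu < succ nu < mu < succ mu], with the middle terms possibly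
   equal. *)
have gam_lt nu mu : (nu < mu)%O -> gamma nu < gamma mu.
  rewrite /gamma /pc_gamma => lt.
  have lt1 : (mu < succ mu)%O by rewrite ltS.
  have := lt; rewrite ltS le_eqVlt => /predU1P[<-|lt2].
    by apply: pc; rewrite ltS.
  by apply: lt_trans (pc _ _ _ _ lt2) (pc _ _ _ lt2 lt1); rewrite ltS.
have dist_incr nu mu : (nu < mu)%O -> w (X - emb (z nu)) < w (X - emb (z mu)).
  by rewrite !limX; apply: gam_lt.
have gam_fin nu : gamma nu < None.
  by apply: lt_le_trans (gam_lt nu (succ nu) _) _; rewrite ?ltS // lex1.
pose g nu : {poly K} := f - (f.[z nu])%:P.
pose P := map_poly em f.
have PE nu : P.[emb (z nu)] = emb f.[z nu] by rewrite emE horner_map.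
pose q nu := (P - (P.[emb (z nu)])%:P) \Po ('X + (emb (z nu))%:P).
have mapg nu : map_poly em (g nu) = P - (P.[emb (z nu)])%:P.
  by rewrite rmorphB /= map_polyC PE.
have coefq nu i : (q nu)`_i = emb (taylor_coef (g nu) (z nu) i).
  rewrite /taylor_coef emE -coef_map map_comp_poly mapg.
  by rewrite [map_poly _ ('X + _)]rmorphD /= map_polyX map_polyC.
have szg nu : size (g nu) = size f.
  by rewrite size_polyDl // size_polyN (leq_ltn_trans (size_polyC_leq1 _)).
(* Recentring turns each root [r] into [r - emb (z nu)], so the ball around [z nu] becomes the ball
   around 0. *)
have vh nu : newton_vertex w (q nu) (w (X - emb (z nu)))
    (j_invariant emb w (z nu) (gamma nu) (g nu)).
  rewrite limX /j_invariant; case: closed_field_poly_normal => rs /= rsE.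
  have lc0 : lead_coef (map_poly em (g nu)) != 0.
    by rewrite lead_coef_eq0 map_poly_eq0 -size_poly_gt0 szg ltnW.
  have := newton_vertex_roots vw [seq r - emb (z nu) | r <- rs] lc0 (gam_fin nu).
  rewrite count_map big_map.
  rewrite (@eq_count _ _ (fun r : L => gamma nu <= w (emb (z nu) - r))); last first.
    by move=> r /=; rewrite (val_distC vw).
  congr (newton_vertex w _ _ _).
  rewrite /q -mapg [in RHS]rsE comp_polyZ; congr (_ *: _).
  rewrite rmorph_prod /=; apply: eq_bigr => r _.
  by rewrite comp_polyB comp_polyC comp_polyX polyCB opprB addrA addrAC.
have [n [b [nu0 [n_gt0 Hn]]]] := eventual_vertex vw no_last dist_incr i0 vh.
have RA : relative_approximation emb w z X f n b.
  split=> //.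
    have [nu lt] := no_last nu0; have [_ wq _] := Hn nu lt.
    exists (taylor_coef (g nu) (z nu) n); last by rewrite /= -coefq.
    by apply/eqP => c0; move: wq; rewrite coefq c0 emE rmorph0 val0.
  by exists nu0 => nu /Hn[_ _]; rewrite PE.
(* Beyond both thresholds the two affine expressions agree at two distinct radii. *)
have uniqRA h beta : relative_approximation emb w z X f h beta ->
    h = n /\ beta = b.
  case=> _ _ [nu1 H1].
  have [nu [lt0 lt1]] : exists nu, (nu0 < nu)%O /\ (nu1 < nu)%O.
    have [nu] := no_last (Order.max nu0 nu1); rewrite gt_max => /andP[? ?].
    by exists nu.
  have [mu lt] := no_last nu.
  have eqn k : (nu0 < k)%O -> (nu1 < k)%O ->
     (Some b : withtop G) + gamma k *+ n = (Some beta : withtop G) + gamma k *+ h.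
    by move=> lk0 lk1; have [_ _] := Hn k lk0; rewrite PE H1 // limX => ->.
  have e1 := eqn nu lt0 lt1.
  have e2 := eqn mu (lt_trans lt0 lt) (lt_trans lt1 lt).
  have bfin (x : G) : (Some x : withtop G) < None by [].
  by have [-> [->]] := wt_affine_inj (gam_lt _ _ lt) (gam_fin mu)
    (bfin _) (bfin _) e1 e2.
split; first by exists n, b.
exists nu0 => nu lt h beta /uniqRA[-> ->] gg c w_nu.
have [jE wq _] := Hn nu lt.
have := vh nu; rewrite jE limX => vn.
have wc i : v (c i) = w (q nu)`_i by rewrite coefq.
(* The coefficient of index [n] has the finite value [b], so it lies within the degree. *)
have n_lt : (n < size f)%N.
  rewrite ltnNge; apply/negP => szn; move: wq; rewrite -/(q nu) coefq /taylor_coef.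
  rewrite nth_default ?size_comp_poly2 ?size_XaddC ?szg // emE rmorph0.
  by rewrite val0.
case: (vn) => vge vgt.
have w_nuE : w_nu gg = v (c n) + gamma nu *+ n.
  rewrite /w_nu /monomial_val szg; apply/le_anti/andP; split.
    exact: (bigmin_le _ (Ordinal n_lt)).
  by apply: le_bigmin => [|i _]; rewrite ?lex1 // !wc.
have termE i : w (emb (c i) * (X - emb (z nu)) ^+ i) = v (c i) + gamma nu *+ i.
  by rewrite (valuationM vw) valX // limX.
split; last by rewrite wc.
  by rewrite -[LHS]jE.
(* The vertex [n] attains the minimum, and the strict inequality beyond it excludes larger
   indices. *)
apply/eqP; rewrite eqn_leq; apply/andP; split; last first.
  apply/bigmax_leqP_seq => i _; rewrite termE w_nuE !wc => /eqP eqi.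
  by rewrite leqNgt; apply/negP => /vgt; rewrite eqi ltxx.
apply: (@leq_bigmax_seq _ _ _ (fun i : nat => i)).
  by rewrite mem_index_iota n_gt0.
by rewrite termE w_nuE.
Qed.
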